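(* The following two statements are equivalent. (i) For every finite dimensional algebra $\Lambda$ (over a field), $\operatorname{findim}(\Lambda) < \infty$ (that is, the little finitistic dimension conjecture holds for all finite dimensional algebras). (ii) For every finite dimensional algebra $\Lambda$ (over a field), if $\operatorname{findim}(\Lambda) < \infty$ then $\operatorname{findim}(\Lambda^{\mathrm{op}}) < \infty$.
   Context: All rings are unital and associative, and modules are right modules. A finite dimensional algebra means a finite dimensional algebra over some field; the quantifiers ''for every finite dimensional algebra'' range over finite dimensional algebras over arbitrary fields. $\Lambda^{\mathrm{op}}$ denotes the opposite algebra of $\Lambda$. The category of finitely generated right $\Lambda$-modules is denoted $\text{mod-}\Lambda$, and $\operatorname{pd}_\Lambda(M)$ denotes the projective dimension of a right $\Lambda$-module $M$. The little finitistic dimension of $\Lambda$ is $$\operatorname{findim}(\Lambda) = \sup\{\operatorname{pd}_\Lambda(M) : M \in \text{mod-}\Lambda \text{ and } \operatorname{pd}_\Lambda(M) < \infty\}.$$ The little finitistic dimension conjecture holds for $\Lambda$ if $\operatorname{findim}(\Lambda) < \infty$. *)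

(* Defs.v *)
From HB Require Import structures.
From mathcomp Require Import all_boot all_order all_algebra.
From mathcomp Require Import falgebra.
From mathcomp Require Import boolp classical_sets constructive_ereal.

Set Implicit Arguments.
Unset Strict Implicit.
Unset Printing Implicit Defensive.

Import Order.TTheory GRing.Theory Num.Theory.
Local Open Scope classical_set_scope.
Local Open Scope ring_scope.

Section OppositeAlgebra.
Variables (k : fieldType) (A : falgType k).

HB.instance Definition _ := GRing.Lmodule.on A^c.

Fact opp_scalerAl (a : k) (x y : A^c) : a *: (x * y) = (a *: x : A^c) * y.
Proof. exact: (@scalerAr k A a y x). Qed.

HB.instance Definition _ :=
  GRing.LSemiModule_isLSemiAlgebra.Build k A^c opp_scalerAl.

Fact opp_scalerAr (a : k) (x y : A^c) : a *: (x * y) = x * (a *: y : A^c).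
Proof. exact: (@scalerAl k A a y x). Qed.

HB.instance Definition _ :=
  GRing.LSemiAlgebra_isSemiAlgebra.Build k A^c opp_scalerAr.
HB.instance Definition _ := Vector.on A^c.

End OppositeAlgebra.

Section Modules.
Variable S : pzRingType.
Implicit Types M P : lmodType S.

Definition finitely_generated M : Prop :=
  exists (n : nat) (g : 'I_n -> M),
    forall x : M, exists a : 'I_n -> S, x = \sum_(i < n) a i *: g i.

Definition projective P : Prop :=
  forall (B C : lmodType S) (p : {linear B -> C}) (f : {linear P -> C}),
    (forall c, exists b, p b = c) ->
    exists h : {linear P -> B}, forall x, p (h x) = f x.

(* ... -> P_2 -> P_1 -> P_0 -> M -> 0, with P_i := pres_obj i. *)
Record proj_resolution M := ProjResolution {
  pres_obj : nat -> lmodType S;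
  pres_diff : forall i, {linear pres_obj i.+1 -> pres_obj i};
  pres_aug : {linear pres_obj 0%N -> M};
  pres_proj : forall i, projective (pres_obj i);
  pres_aug_surj : forall m, exists x, pres_aug x = m;
  pres_exact0 : forall x, pres_aug x = 0 <-> exists y, pres_diff 0%N y = x;
  pres_exactS : forall i x,
    pres_diff i x = 0 <-> exists y, pres_diff i.+1 y = x }.

Definition pres_length_le M (P : proj_resolution M) (n : nat) : Prop :=
  forall i, (n < i)%N -> forall x : pres_obj P i, x = 0.

(* Dimensions live in \bar int because \bar nat carries no order; pd is +oo
   when there is no finite resolution, and pd = 0 for the zero module. *)
Definition pd M : \bar int :=
  infimum +oo%E [set n%:Z%:E | n in
    [set n | exists P : proj_resolution M, pres_length_le P n]].

End Modules.

(* A right module over R is a left module over the converse ring R^c. *)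
Notation rmodType R := (lmodType R^c).

(* The default value 0 is never used: the set contains pd of the zero module.
   An falgType is a nonzero algebra; over the zero ring all modules are zero,
   so its findim is 0. *)
Definition findim (R : pzRingType) : \bar int :=
  supremum 0%E [set d | exists M : rmodType R,
    [/\ finitely_generated M, (pd M < +oo)%E & d = pd M]].

(* Main.v *)
(* For a finite dimensional algebra L put A := L^op, C := A x k with its
   projection chi : C -> k, and B := C (+) DC, where DC = Hom_k(C, k) is a
   square-zero ideal on which C acts from the left as usual and from the right
   through chi.

   Right modules over B have finitistic dimension 0.  By dimension shifting it
   suffices to split an injection i : P -> B^n with P finitely generated
   projective.  Since P * DC = P (x) DC, a map P -> C is the same as a
   functional on P * DC; it extends along i because k is a field, so every
   map P -> B extends to B^n modulo DC.  A dual basis of P then gives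
   g : B^n -> P such that 1 - g i maps P into P * DC, hence has square zero,
   and i splits.

   On the other side, A is the projective left B-module B e with
   e = ((1, 0), 0), so A-modules keep their projective dimension when viewed as
   left B-modules.  Hence a bound on findim (B^op) is a bound on findim L. *)
From HB Require Import structures.
Require Import Defs.
From mathcomp Require Import all_boot all_order all_algebra.
From mathcomp Require Import falgebra.
From mathcomp Require Import boolp classical_sets constructive_ereal.

Set Implicit Arguments.
Unset Strict Implicit.
Unset Printing Implicit Defensive.

Import Order.TTheory GRing.Theory Num.Theory.
Local Open Scope ring_scope.

(** * Linear maps, short exact sequences and projective dimension by iterated syzygies *)

Section Linear.
Variable S : pzRingType.
Implicit Types M N P Q K L E : lmodType S.

Definition mklin M N (f : M -> N) (f_lin : linear f) : {linear M -> N} :=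
  HB.pack f (GRing.isLinear.Build S M N _ f f_lin).

Section Kernel.
Variables (M N : lmodType S) (f : {linear M -> N}).

Definition ker_pred : {pred M} := fun x => f x == 0.

Fact ker_pred_submod : submod_closed ker_pred.
Proof.
split=> [|a x y]; rewrite !unfold_in /= ?linear0 //.
by move=> /eqP fx0 /eqP fy0; rewrite linearP fx0 fy0 scaler0 addr0.
Qed.

HB.instance Definition _ :=
  GRing.isSubmodClosed.Build S M ker_pred ker_pred_submod.

Definition ker := {x : M | x \in ker_pred}.

HB.instance Definition _ := SubChoice.on ker.
HB.instance Definition _ := [SubChoice_isSubLmodule of ker by <:].

Lemma ker_val (x : ker) : f (val x) = 0.
Proof. exact: eqP (valP x). Qed.

Lemma ker_subP (x : M) : f x = 0 <-> exists y : ker, val y = x.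
Proof.
split=> [fx0|[y <-]]; last exact: ker_val.
by have kx : x \in ker_pred by [apply/eqP]; exists (Sub x kx).
Qed.

Section Lift.
Variables (L : lmodType S) (g : {linear L -> M}).
Hypothesis fg0 : forall x, f (g x) = 0.

Definition ker_lift_fun (x : L) : ker := Sub (g x) (introT eqP (fg0 x)).

Fact ker_lift_linear : linear ker_lift_fun.
Proof.
by move=> a x y; apply: val_inj; exact: linearP.
Qed.

Definition ker_lift : {linear L -> ker} := mklin ker_lift_linear.
End Lift.

End Kernel.
Fact lin_inv_linear M N (f : {linear M -> N}) (g : N -> M) :
  cancel f g -> cancel g f -> linear g.
Proof. by move=> fK gK a x y; apply: (can_inj fK); rewrite linearP !gK. Qed.

Lemma bij_linear_inv M N (f : {linear M -> N}) :
  injective f -> (forall y, exists x, f x = y) ->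
  exists g : {linear N -> M}, cancel f g /\ cancel g f.
Proof.
move=> f_inj /choice[g gK].
have fK : cancel f g by move=> x; apply: f_inj; rewrite gK.
by exists (mklin (lin_inv_linear fK gK)).
Qed.

Lemma projective_retract P Q (s : {linear P -> Q}) (r : {linear Q -> P}) :
  cancel s r -> projective Q -> projective P.
Proof.
move=> sK projQ B C p f p_surj.
have [h ph] := projQ B C p (f \o r)%R p_surj.
by exists (h \o s)%R => x /=; rewrite ph /= sK.
Qed.

Fact pair_inl_linear M N : linear (fun x : M => (x, 0) : M * N).
Proof.
move=> a x y; have e : 0 = a *: 0 + 0 :> N by rewrite scaler0 addr0.
exact: (congr1 (pair _) e).
Qed.

Fact pair_inr_linear M N : linear (fun x : N => (0, x) : M * N).
Proof.
move=> a x y; have e : 0 = a *: 0 + 0 :> M by rewrite scaler0 addr0.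
exact: (congr1 (pair^~ _) e).
Qed.

Definition pair_inl M N := mklin (@pair_inl_linear M N).
Definition pair_inr M N := mklin (@pair_inr_linear M N).

Lemma projective_prod P Q :
  projective P -> projective Q -> projective (P * Q)%type.
Proof.
move=> projP projQ B C p f p_surj.
have [h1 ph1] := projP B C p (f \o pair_inl P Q)%R p_surj.
have [h2 ph2] := projQ B C p (f \o pair_inr P Q)%R p_surj.
have hl : linear (fun x : P * Q => h1 x.1 + h2 x.2).
  by move=> a x y; rewrite /= !linearP scalerDr addrACA.
exists (mklin hl) => -[x y]; rewrite /= linearD ph1 ph2 /= -linearD.
by rewrite -[x in RHS]addr0 -[y in RHS]add0r.
Qed.

Definition ses K P M (j : {linear K -> P}) (p : {linear P -> M}) : Prop :=
  [/\ injective j, forall m, exists x, p x = m &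
      forall x, p x = 0 <-> exists y, j y = x].

(** The bound pd <= n in inductive form, suited to dimension shifting; [resolution_pdle] and
    [pdle_resolution] match it with [proj_resolution]. *)
Fixpoint pdle (n : nat) M : Prop :=
  if n is m.+1 then
    exists (K P : lmodType S) (j : {linear K -> P}) (p : {linear P -> M}),
      [/\ projective P, ses j p & pdle m K]
  else projective M.

Lemma ses_ker P M (p : {linear P -> M}) :
  (forall m, exists x, p x = m) -> ses (val : {linear ker p -> P}) p.
Proof. by move=> p_surj; split=> // [|x]; [exact: val_inj|exact: ker_subP]. Qed.

Lemma ses_split K P M (j : {linear K -> P}) (p : {linear P -> M}) :
  ses j p -> projective M ->
  exists (f : {linear (K * M)%type -> P}) (g : {linear P -> (K * M)%type}),
    cancel f g /\ cancel g f.
Proof.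
move=> jp projM; have [j_inj p_surj p_ker] := jp.
have [s sK] := projM _ _ p idfun p_surj.
have pj0 y : p (j y) = 0 by apply/p_ker; exists y.
have fl : linear (fun x : K * M => j x.1 + s x.2).
  by move=> a x y; rewrite /= !linearP scalerDr addrACA.
exists (mklin fl); apply: bij_linear_inv => [x y /= xy|x].
  have /= xy2 := congr1 p xy; rewrite !linearD !pj0 !add0r !sK /= in xy2.
  move: xy; rewrite xy2 => /addIr/j_inj xy1.
  by case: x y xy1 xy2 => ? ? [? ?] /= -> ->.
have /p_ker[y jy] : p (x - s (p x)) = 0 by rewrite linearB sK /= subrr.
by exists (y, p x); rewrite /= jy subrK.
Qed.

(** The endomorphism [id - j r] vanishes on the kernel of [p], so composing it with any choice of
    preimages under [p] gives a linear section. *)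
Lemma ses_retract_section K P M (j : {linear K -> P}) (p : {linear P -> M})
    (r : {linear P -> K}) :
  ses j p -> cancel j r -> exists s : {linear M -> P}, cancel s p.
Proof.
move=> [j_inj p_surj p_ker] jK; have /choice[c cK] := p_surj.
pose e : {linear P -> P} := (idfun \- (j \o r))%R.
have ej0 x : p x = 0 -> e x = 0.
  by move=> /p_ker[y <-]; rewrite /e /= jK subrr.
have ec_lin : linear (fun m => e (c m)).
  move=> a x y; apply/eqP; rewrite -linearP -subr_eq0 -linearB; apply/eqP/ej0.
  by rewrite linearB linearP !cK subrr.
exists (mklin ec_lin) => m; rewrite /= linearB cK.
by rewrite [p (j _)](_ : _ = 0) ?subr0 //; apply/p_ker; exists (r (c m)).
Qed.

Lemma pdle_iso n M N (f : {linear M -> N}) (g : {linear N -> M}) :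
  cancel f g -> cancel g f -> pdle n M -> pdle n N.
Proof.
move=> fK gK; case: n => [|n] /=; first exact: projective_retract gK.
move=> [K [P [j [p [projP [j_inj p_surj p_ker] pdK]]]]].
exists K, P, j, (f \o p)%R; split=> //; split=> // [y|x].
  by have [x px] := p_surj (g y); exists x; rewrite /= px gK.
rewrite -p_ker /=; split=> [fpx0|->]; last exact: linear0.
by apply: (can_inj fK); rewrite fpx0 linear0.
Qed.

Lemma pdle_prod n M Q : projective Q -> pdle n M -> pdle n (M * Q)%type.
Proof.
case: n => [|n] /= projQ; first by move=> projM; apply: projective_prod.
move=> [K [P [j [p [projP [j_inj p_surj p_ker] pdK]]]]].
have p'l : linear (fun x : P * Q => (p x.1, x.2) : M * Q).
  by move=> a x y; rewrite /= linearP.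
exists K, (P * Q)%type, (pair_inl P Q \o j), (mklin p'l).
split=> //; [exact: projective_prod|split].
- by move=> x y [/j_inj].
- by move=> [m q] /=; have [x <-] := p_surj m; exists (x, q).
move=> [x q] /=; split=> [[px0 q0]|[y [<- <-]]].
  by have [y <-] := (p_ker x).1 px0; exists y; rewrite /= q0.
by have /p_ker -> : exists z, j z = j y by exists y.
Qed.

(** The kernel of P -> M * Q -> M is an extension of [Q] by [K]; it splits as [Q] is projective, so
    K * Q is a syzygy of [M]. *)
Lemma pdle_prod_inv n M Q : projective Q -> pdle n (M * Q)%type -> pdle n M.
Proof.
case: n => [|n] /= projQ.
  by apply: (projective_retract (s := pair_inl M Q) (r := fst)).
move=> [K [P [j [p [projP jp pdK]]]]].
have [j_inj p_surj p_ker] := jp.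
have pj0 y : p (j y) = 0 by apply/p_ker; exists y.
pose p1 : {linear P -> M} := (fst \o p)%R.
have p1_surj m : exists x, p1 x = m.
  by have [x px] := p_surj (m, 0); exists x; rewrite /p1 /= px.
exists (ker p1), P, val, p1; split=> //; first exact: ses_ker.
pose p2 : {linear ker p1 -> Q} := (snd \o (p \o val))%R.
have p1j0 x : p1 (j x) = 0 by rewrite /p1 /= pj0.
pose j' := ker_lift p1j0.
have jp2 : ses j' p2.
  split=> [x y /(congr1 val)/j_inj //|q|x].
    have [x px] := p_surj (0, q).
    have /ker_subP[y yx] : p1 x = 0 by rewrite /p1 /= px.
    by exists y; rewrite /p2 /= yx px.
  split=> [p2x0|[y <-]]; last by rewrite /p2 /= pj0.
  have /p_ker[y jy] : p (val x) = 0.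
    have := ker_val x; rewrite /p1 /= => p1x0; apply/pair_eqP.
    by rewrite /eq_op /= p1x0 [X in _ && (X == _)]p2x0 !eqxx.
  by exists y; apply: val_inj.
have [f [g [fK gK]]] := ses_split jp2 projQ.
exact: pdle_iso fK gK (pdle_prod _ pdK).
Qed.

(* Schanuel's lemma: the pullback of [p] and [q] is both [K * Q] and [L * P]. *)
Lemma pdle_syzygy n M L Q (l : {linear L -> Q}) (q : {linear Q -> M}) :
  ses l q -> projective Q -> pdle n.+1 M -> pdle n L.
Proof.
move=> lq projQ [K [P [j [p [projP jp pdK]]]]].
have [l_inj q_surj q_ker] := lq; have [j_inj p_surj p_ker] := jp.
have dl : linear (fun x : P * Q => p x.1 - q x.2).
  by move=> a x y; rewrite /= !linearP scalerDr addrACA.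
pose E : lmodType S := ker (mklin dl).
have Eeq (x : E) : p (val x).1 = q (val x).2.
  by apply/eqP; rewrite -subr_eq0; apply/eqP/(ker_val x).
have Emem x y : p x = q y -> exists z : E, val z = (x, y).
  by move=> pq; apply/ker_subP; rewrite /= pq subrr.
have dj0 x : mklin dl ((pair_inl P Q \o j) x) = 0.
  by rewrite /= linear0 subr0; apply/p_ker; exists x.
have dl0 x : mklin dl ((pair_inr P Q \o l) x) = 0.
  by rewrite /= linear0 sub0r (_ : q _ = 0) ?oppr0 //; apply/q_ker; exists x.
pose e1 : {linear E -> P} := (fst \o val)%R.
pose e2 : {linear E -> Q} := (snd \o val)%R.
have je2 : ses (ker_lift dj0) e2.
  split=> [x y /(congr1 val)[/j_inj]//|y|x].
    have [x px] := p_surj (q y); have [z zE] := Emem _ _ px.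
    by exists z; rewrite /e2 /= zE.
  split=> [x20|[y <-]//]; have := Eeq x; rewrite [(val x).2]x20 linear0.
  move=> /p_ker[y jy]; exists y; apply: val_inj => /=.
  rewrite jy -[X in (_, X)]x20.
  by rewrite -surjective_pairing.
have le1 : ses (ker_lift dl0) e1.
  split=> [x y /(congr1 val)[/l_inj]//|x|x].
    have [y qy] := q_surj (p x); have [z zE] := Emem _ _ (esym qy).
    by exists z; rewrite /e1 /= zE.
  split=> [x10|[y <-]//].
  have := Eeq x; rewrite [(val x).1]x10 linear0 => /esym.
  move=> /q_ker[y jy]; exists y; apply: val_inj => /=.
  rewrite jy -[X in (X, _)]x10.
  by rewrite -surjective_pairing.
have [f [g [fK gK]]] := ses_split je2 projQ.
have [f' [g' [fK' gK']]] := ses_split le1 projP.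
apply: pdle_prod_inv projP _; apply: pdle_iso gK' fK' _.
by apply: pdle_iso fK gK _; apply: pdle_prod.
Qed.

Lemma pdle_leS n M : pdle n M -> pdle n.+1 M.
Proof.
elim: n M => [|n IHn] M; last first.
  move=> [K [P [j [p [projP jp pdK]]]]].
  by exists K, P, j, p; split=> //; apply: IHn.
move=> projM; exists (ker (idfun : {linear M -> M})), M, val, idfun; split=> //.
  by apply: ses_ker => m; exists m.
move=> B C p f p_surj; exists \0%R => x; rewrite linear0.
have -> : x = 0 by apply: val_inj; exact: (ker_val x).
by rewrite linear0.
Qed.

Lemma pdle_le m n M : (m <= n)%N -> pdle m M -> pdle n M.
Proof.
by move=> /subnK <-; elim: (n - m)%N => // d IHd /IHd; exact: pdle_leS.
Qed.

(** The resolution with P_0 removed resolves the kernel of the augmentation and is shorter by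
    one. *)
Lemma resolution_pdle n M (P : proj_resolution M) :
  pres_length_le P n -> pdle n M.
Proof.
elim: n M P => [|n IHn] M P Pn.
  (* As P_1 = 0, the augmentation is injective, hence an isomorphism from P_0 to [M]. *)
  have [g [fK gK]] : exists g : {linear M -> pres_obj P 0},
      cancel (pres_aug P) g /\ cancel g (pres_aug P).
    apply: bij_linear_inv; last exact: pres_aug_surj.
    apply: raddf_inj => x /pres_exact0[y <-].
    by rewrite (Pn 1%N isT y) linear0.
  by apply: (projective_retract gK); exact: pres_proj.
have aug0 x : pres_aug P (pres_diff P 0 x) = 0 by apply/pres_exact0; exists x.
have R1 i : projective (pres_obj P i.+1) by exact: pres_proj.
have R2 m : exists x, ker_lift aug0 x = m.
  have /pres_exact0[y yE] := ker_val m; exists y; exact: val_inj.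
have R3 x : ker_lift aug0 x = 0 <-> exists y, pres_diff P 1 y = x.
  rewrite -pres_exactS; split=> [/(congr1 val)//|x0]; exact: val_inj.
exists (ker (pres_aug P)), (pres_obj P 0), val, (pres_aug P); split.
- exact: pres_proj.
- by apply: ses_ker; exact: pres_aug_surj.
- apply: (IHn _ (ProjResolution R1 R2 R3 (fun i => @pres_exactS _ _ P i.+1))).
  by move=> i ni x; apply: Pn.
Qed.

Section Splice.
Variables (K P M : lmodType S) (j : {linear K -> P}) (p : {linear P -> M}).
Variable R : proj_resolution K.

(** The resolution ... -> R_1 -> R_0 -> P -> M, where R_0 -> P passes through [K]. *)
Definition splice_obj (i : nat) : lmodType S :=
  if i is i'.+1 then pres_obj R i' else P.

Definition splice_diff (i : nat) : {linear splice_obj i.+1 -> splice_obj i} :=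
  match i return {linear splice_obj i.+1 -> splice_obj i} with
  | 0 => (j \o pres_aug R)%R
  | i'.+1 => pres_diff R i'
  end.

Lemma splice_resolution : projective P -> ses j p ->
  exists R' : proj_resolution M,
    forall n, pres_length_le R n -> pres_length_le R' n.+1.
Proof.
move=> projP [j_inj p_surj p_ker].
have R1 i : projective (splice_obj i) by case: i => [|i] //; exact: pres_proj.
have R3 x : p x = 0 <-> exists y, splice_diff 0 y = x.
  rewrite p_ker; split=> -[y <-]; last by exists (pres_aug R y).
  by have [z <-] := pres_aug_surj R y; exists z.
have R4 i x : splice_diff i x = 0 <-> exists y, splice_diff i.+1 y = x.
  case: i x => [|i] x; last exact: pres_exactS.
  rewrite -pres_exact0 /=; split=> [jx0|->]; last exact: linear0.
  by apply: j_inj; rewrite jx0 linear0.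
by exists (ProjResolution R1 p_surj R3 R4) => n Rn [|i] // ni x; apply: Rn.
Qed.
End Splice.

Lemma pdle_resolution n M : pdle n M ->
  exists P : proj_resolution M, pres_length_le P n.
Proof.
elim: n M => [|n IHn] M /=; last first.
  move=> [K [P [j [p [projP jp /IHn[R Rn]]]]]].
  by have [R' RR'] := splice_resolution R projP jp; exists R'; exact: RR'.
move=> projM; pose Z := ker (idfun : {linear M -> M}).
have Z0 (x : Z) : x = 0 by apply: val_inj; exact: (ker_val x).
have projZ : projective Z.
  by move=> B C p f p_surj; exists \0%R => x; rewrite (Z0 x) !linear0.
pose o i : lmodType S := if i is _.+1 then Z else M.
pose d i : {linear o i.+1 -> o i} := \0%R.
have R1 i : projective (o i) by case: i.
have R2 (m : M) : exists x, (idfun : {linear o 0%N -> M}) x = m by exists m.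
have R3 x : (idfun : {linear o 0%N -> M}) x = 0 <-> exists y, d 0%N y = x.
  by split=> [/= ->|[y <-]//]; exists 0.
have R4 i x : d i x = 0 <-> exists y, d i.+1 y = x.
  by split=> // _; exists 0; rewrite linear0; apply/esym/Z0.
by exists (ProjResolution R1 R2 R3 R4) => -[|i] // _ x; exact: Z0.
Qed.

End Linear.

(** * Numerical projective and finitistic dimension *)

Lemma infimum_min (d : Order.disp_t) (T : porderType d) (x0 x : T) (A : set T) :
  A x -> (forall y, A y -> (x <= y)%O) -> infimum x0 A = x.
Proof.
move=> Ax x_min; rewrite /infimum ifF; last first.
  by apply/negP => /eqP A0; rewrite A0 in Ax.
have infx : infimums A x by split=> // y /(_ _ Ax).
by apply: is_subset1_infimums (infx); apply: xgetPex; exists x.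
Qed.

Section Dimensions.
Variable S : pzRingType.

Lemma pd_lt_pinfty (M : lmodType S) : (pd M < +oo)%E -> exists n, pdle n M.
Proof.
move=> pdM; apply: contrapT => noM; move: pdM; rewrite /pd /infimum.
(* With no finite resolution the set is empty and [infimum] returns its default [+oo]. *)
case: eqP => [|/eqP/set0P[d [n [P Pn] _]]]; first by rewrite ltxx.
by exfalso; apply: noM; exists n; exact: resolution_pdle Pn.
Qed.

Lemma pd_min (M : lmodType S) : (exists n, pdle n M) ->
  exists n, [/\ pdle n M, pd M = n%:Z%:E & forall m, pdle m M -> (n <= m)%N].
Proof.
move=> exM; have exM' : exists n, `[< pdle n M >].
  by have [n Mn] := exM; exists n; apply/asboolP.
case: (ex_minnP exM') => n /asboolP Mn n_min.
have n_le m : pdle m M -> (n <= m)%N by move=> /asboolP/n_min.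
exists n; split=> //; apply: infimum_min.
  by exists n => //; exact: pdle_resolution.
move=> _ [m [P Pm] <-]; rewrite lee_fin lez_nat n_le //.
exact: resolution_pdle Pm.
Qed.

Lemma pdleP n (M : lmodType S) : pdle n M <-> (pd M <= n%:Z%:E)%E.
Proof.
split=> [Mn|pdMn].
  have [m [_ -> m_min]] := pd_min (ex_intro _ n Mn).
  by rewrite lee_fin lez_nat m_min.
have [|m [Mm pdM _]] := @pd_min M.
  by apply: pd_lt_pinfty; apply: le_lt_trans pdMn _; rewrite ltry.
by move: pdMn; rewrite pdM lee_fin lez_nat => /pdle_le; apply.
Qed.
End Dimensions.

(** Were there no uniform bound [N], [+oo] would be the only supremum of the set of dimensions. *)
Lemma findim_lt_pinfty (R : pzRingType) : (findim R < +oo)%E <->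
  exists N, forall M : rmodType R,
    finitely_generated M -> (exists n, pdle n M) -> pdle N M.
Proof.
rewrite /findim; set A := (X in supremum _ X); split=> [findimR|[N leN]].
  apply: contrapT => unbounded; suff infA : supremums A +oo%E.
    move: findimR; rewrite /supremum ifF.
      have := xgetPex 0%E (ex_intro _ _ infA).
      by move=> /is_subset1_supremums/(_ infA) ->; rewrite ltxx.
    apply/negP => /eqP A0; apply: unbounded; exists 0%N => M fgM Mn; exfalso.
    suff : A (pd M) by rewrite A0.
    by exists M; split=> //; have [n [_ -> _]] := pd_min Mn; rewrite ltry.
  split=> [d _|u ubu]; first exact: leey.
  (* An upper bound exceeding every natural number can only be [+oo]. *)
  suff bigu N : (N%:Z%:E < u)%E.
    case: u {ubu} bigu => [z| |] // bigu; last by have := bigu 0%N.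
    by have := bigu `|z|%N; rewrite lte_fin abszE ltNge ler_norm.
  rewrite ltNge; apply/negP => uN; apply: unbounded; exists N => M fgM Mn.
  apply/pdleP; apply: le_trans uN; apply: ubu; exists M; split=> //.
  by have [n [_ -> _]] := pd_min Mn; rewrite ltry.
rewrite /supremum; case: ifP => // _; case: xgetP => [d _ [_ d_le]|//].
apply: (@le_lt_trans _ _ N%:Z%:E); last by rewrite ltry.
apply: d_le => _ [M [fgM /pd_lt_pinfty Mn ->]]; apply/pdleP; exact: leN.
Qed.

HB.instance Definition _ (k : fieldType) (A B : falgType k) :=
  Vector.on (A * B)%type.

(** * The algebra B = C (+) DC *)

Section DualExtension.
Variables (k : fieldType) (C : falgType k).

Definition dual_ext (chi : {lrmorphism C -> k^o}) : Type := C * 'Hom(C, k^o).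

Variable chi : {lrmorphism C -> k^o}.
Local Notation B := (dual_ext chi).

HB.instance Definition _ := Vector.on B.

Fact dual_lmul_linear (c : C) (f : 'Hom(C, k^o)) :
  linear (fun y => f (y * c) : k^o).
Proof. by move=> a x y; rewrite mulrDl -scalerAl linearP. Qed.

Definition dual_lmul (c : C) (f : 'Hom(C, k^o)) : 'Hom(C, k^o) :=
  linfun (mklin (dual_lmul_linear c f)).

Lemma dual_lmulE c f y : dual_lmul c f y = f (y * c).
Proof. exact: lfunE. Qed.

(** Square-zero extension: (c, f)(d, g) = (cd, cg + fd), where c acts by [dual_lmul] and fd = chi(d)
    f. *)
Definition dual_ext_mul (x y : B) : B :=
  (x.1 * y.1, dual_lmul x.1 y.2 + (chi y.1 : k) *: x.2).

Definition dual_ext_one : B := (1, 0).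

Lemma dual_extP (x y : B) : x.1 = y.1 -> x.2 =1 y.2 -> x = y.
Proof. by case: x y => [c f] [d g] /= -> fg; congr (_, _); apply/lfunP. Qed.

Lemma dual_ext_mulE x y w :
  (dual_ext_mul x y).2 w = y.2 (w * x.1) + chi y.1 * x.2 w.
Proof. by rewrite add_lfunE scale_lfunE dual_lmulE. Qed.

Fact dual_ext_mulA : associative dual_ext_mul.
Proof.
move=> x y z; apply: dual_extP => [|w]; first exact: mulrA.
rewrite !dual_ext_mulE /= rmorphM mulrDr addrA !mulrA.
by rewrite [chi z.1 * chi y.1]mulrC.
Qed.

Fact dual_ext_mul1 : left_id dual_ext_one dual_ext_mul.
Proof.
move=> x; apply: dual_extP => [|w]; first exact: mul1r.
by rewrite dual_ext_mulE zero_lfunE mulr0 addr0 mulr1.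
Qed.

Fact dual_ext_1mul : right_id dual_ext_one dual_ext_mul.
Proof.
move=> x; apply: dual_extP => [|w]; first exact: mulr1.
by rewrite dual_ext_mulE zero_lfunE rmorph1 mul1r add0r.
Qed.

Fact dual_ext_mulDl : left_distributive dual_ext_mul +%R.
Proof.
move=> x y z; apply: dual_extP => [|w]; first exact: mulrDl.
rewrite [RHS]add_lfunE !dual_ext_mulE /= mulrDr linearD add_lfunE mulrDr.
exact: addrACA.
Qed.

Fact dual_ext_mulDr : right_distributive dual_ext_mul +%R.
Proof.
move=> x y z; apply: dual_extP => [|w]; first exact: mulrDr.
by rewrite [RHS]add_lfunE !dual_ext_mulE /= add_lfunE rmorphD mulrDl addrACA.
Qed.

Fact dual_ext_1neq0 : dual_ext_one != 0.
Proof. by apply/eqP => -[/eqP]; rewrite oner_eq0. Qed.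

HB.instance Definition _ := GRing.Zmodule_isNzRing.Build B
  dual_ext_mulA dual_ext_mul1 dual_ext_1mul dual_ext_mulDl dual_ext_mulDr
  dual_ext_1neq0.

Fact dual_ext_scalerAl (a : k) (x y : B) : a *: (x * y) = (a *: x) * y.
Proof.
apply: dual_extP => [|w]; first exact: scalerAl.
rewrite scale_lfunE [(x * y).2 _]dual_ext_mulE [RHS]dual_ext_mulE /=.
by rewrite scale_lfunE -scalerAr linearZ scalerDr [a *: (_ * _)]mulrCA.
Qed.

HB.instance Definition _ :=
  GRing.LSemiModule_isLSemiAlgebra.Build k B dual_ext_scalerAl.

Fact dual_ext_scalerAr (a : k) (x y : B) : a *: (x * y) = x * (a *: y).
Proof.
apply: dual_extP => [|w]; first exact: scalerAr.
rewrite scale_lfunE [(x * y).2 _]dual_ext_mulE [RHS]dual_ext_mulE /=.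
by rewrite scale_lfunE linearZ scalerDr -scalerAl.
Qed.

HB.instance Definition _ :=
  GRing.LSemiAlgebra_isSemiAlgebra.Build k B dual_ext_scalerAr.
HB.instance Definition _ := Algebra_isFalgebra.Build k B.

Lemma dual_ext_mul2E (x y : B) (w : C) :
  (x * y).2 w = y.2 (w * x.1) + chi y.1 * x.2 w.
Proof. exact: dual_ext_mulE. Qed.

End DualExtension.

(** * Free modules, finite generation and dual bases *)

Section Free.
Variable S : pzRingType.
Implicit Types M N P : lmodType S.

Definition free_mod n : lmodType S := {ffun 'I_n -> S^o}.

Fact lincomb_linear n M (g : 'I_n -> M) :
  linear (fun a : free_mod n => \sum_(i < n) (a i : S) *: g i).
Proof.
move=> c x y; rewrite scaler_sumr -big_split; apply: eq_bigr => i _ /=.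
by rewrite !ffunE scalerDl scalerA.
Qed.

Definition lincomb n M (g : 'I_n -> M) : {linear free_mod n -> M} :=
  mklin (lincomb_linear g).

Lemma lincombE n M (g : 'I_n -> M) a :
  lincomb g a = \sum_(i < n) (a i : S) *: g i.
Proof. by []. Qed.

Definition unit_vec n (i : 'I_n) : free_mod n := [ffun j => (i == j)%:R].

Lemma free_sum n (a : free_mod n) : a = \sum_(i < n) (a i : S) *: unit_vec i.
Proof.
apply/ffunP => j; rewrite sum_ffunE (bigD1 j) //= big1 ?addr0 => [|i ij].
  by rewrite !ffunE eqxx; exact/esym/mulr1.
by rewrite !ffunE (negbTE ij); exact: mulr0.
Qed.

Lemma free_projective n : projective (free_mod n).
Proof.
move=> B C p f p_surj.
have /choice[b pb] : forall i, exists b, p b = f (unit_vec i) by move=> i.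
exists (lincomb b) => a; rewrite {2}[a]free_sum !linear_sum /=.
by apply: eq_bigr => i _; rewrite !linearZ /= pb.
Qed.

Lemma fg_cover M : finitely_generated M ->
  exists n (g : 'I_n -> M), forall x, exists a, lincomb g a = x.
Proof.
move=> [n [g Mg]]; exists n, g => x; have [a ->] := Mg x.
by exists [ffun i => a i]; apply: eq_bigr => i _; rewrite ffunE.
Qed.

Lemma ker_fg M N (f : {linear M -> N}) m (v : 'I_m -> M) :
  (forall i, f (v i) = 0) ->
  (forall x, f x = 0 -> exists a : 'I_m -> S, x = \sum_i a i *: v i) ->
  finitely_generated (ker f).
Proof.
move=> fv0 v_span; have /choice[g gE] : forall i, exists g : ker f, val g = v i.
  by move=> i; apply/ker_subP.
exists m, g => x; have [a xE] := v_span _ (ker_val x); exists a; apply: val_inj.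
by rewrite xE linear_sum; apply: eq_bigr => i _; rewrite -gE linearZ.
Qed.

(** A splitting [q] of a free cover supplies the coordinates: x is the sum of the (q x)_j g_j. *)
Lemma projective_dual_basis P : projective P -> finitely_generated P ->
  exists n (g : 'I_n -> P) (q : {linear P -> free_mod n}), cancel q (lincomb g).
Proof.
move=> projP /fg_cover[n [g g_surj]]; exists n, g.
by have [q qK] := projP _ _ (lincomb g) idfun g_surj; exists q.
Qed.
End Free.

(** * Duality for finite dimensional vector spaces *)

Section Dual.
Variables (k : fieldType) (V : vectType k).

Let e := vbasis (@fullv k V).

Fact dual_coord_linear i : linear (fun v => coord e i v : k^o).
Proof. by move=> a x y; rewrite linearP. Qed.

Let ed i : 'Hom(V, k^o) := linfun (mklin (dual_coord_linear i)).

Let edE i v : ed i v = coord e i v. Proof. exact: lfunE. Qed.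

Let e_sum v : v = \sum_i ed i v *: e`_i.
Proof.
rewrite {1}(coord_basis (vbasisP _) (memvf v)).
by apply: eq_bigr => i _; rewrite edE.
Qed.

Lemma dual_separates (v w : V) : (forall f : 'Hom(V, k^o), f v = f w) -> v = w.
Proof.
by move=> vw; rewrite (e_sum v) (e_sum w); apply: eq_bigr => i _; rewrite vw.
Qed.

(** The vector representing [Psi] has the values of [Psi] on the dual basis as coordinates. *)
Lemma dual_reflexive (Psi : 'Hom(V, k^o) -> k^o) :
  linear Psi -> exists v, forall f, Psi f = f v.
Proof.
move=> Psi_lin; pose Psi' := mklin Psi_lin.
exists (\sum_i Psi (ed i) *: e`_i) => f.
have {1}-> : f = \sum_(i < \dim (@fullv k V)) f e`_i *: ed i.
  apply/lfunP => v; rewrite sum_lfunE {1}(e_sum v) linear_sum.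
  by apply: eq_bigr => i _; rewrite linearZ scale_lfunE; exact: mulrC.
rewrite -[Psi]/(Psi' : _ -> _) !linear_sum; apply: eq_bigr => i _.
by rewrite !linearZ; exact: mulrC.
Qed.
End Dual.

(** [(g^-1)%VF] is linear on all of [W] and picks preimages on the image of [g], so a map factoring
    through that image extends to [W]. *)
Lemma linear_factor (k : fieldType) (V W : vectType k) (U : lmodType k)
    (G : V -> W) (t : V -> U) :
  linear G -> linear t -> (forall x y, G x = G y -> t x = t y) ->
  exists2 s : W -> U, linear s & forall x, s (G x) = t x.
Proof.
move=> G_lin t_lin tG; pose g := linfun (mklin G_lin).
have gE x : g x = G x by rewrite lfunE.
exists (fun y => t ((g^-1)%VF y)) => [a x y|x]; first by rewrite linearP t_lin.
by apply: tG; rewrite -!gE limg_lfunVK ?memv_img ?memvf.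
Qed.

(** * Splitting of embeddings of projective right B-modules into free ones *)

Section Split.
Variables (k : fieldType) (C : falgType k) (chi : {lrmorphism C -> k^o}).
Local Notation B := (dual_ext chi).

Definition dual_ideal (f : 'Hom(C, k^o)) : B := (0, f).

Lemma dual_idealP a f g :
  dual_ideal (a *: f + g) = (a%:A : B^c) * dual_ideal f + dual_ideal g :> B^c.
Proof.
rewrite (@mulr_algl k B^c); apply: (@dual_extP _ _ chi) => //.
by rewrite /= scaler0 addr0.
Qed.

(** In [B] this is the product b (0, f), so only the left action on DC enters. *)
Lemma mul_dual_ideal (b : B) f :
  (dual_ideal f : B^c) * b = dual_ideal (dual_lmul b.1 f) :> B^c.
Proof.
apply: (@dual_extP _ _ chi) => [|w]; first exact: mulr0.
by rewrite [LHS]dual_ext_mul2E dual_lmulE raddf0 mul0r addr0.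
Qed.

Lemma converse_scale1E (b : B^c) (y : (B^c)^o) :
  ((b *: y : B^c) : B).1 = (y : B).1 * (b : B).1.
Proof. by []. Qed.

Lemma converse_sum1E I (r : seq I) (F : I -> (B^c)^o) :
  ((\sum_(j <- r) F j : (B^c)^o) : B).1 = \sum_(j <- r) (F j : B).1.
Proof. exact: (big_morph (fun x : (B^c)^o => (x : B).1)). Qed.

(* The same carrier, as a k-space and as a right B-module; keeping the casts
   explicit spares the unifier comparisons between the two structures. *)
Definition free_of_ffun p (x : {ffun 'I_p -> B}) : free_mod B^c p := x.
Definition ffun_of_free p (x : free_mod B^c p) : {ffun 'I_p -> B} := x.

Lemma free_of_ffunK p : cancel (@free_of_ffun p) (@ffun_of_free p).
Proof. by []. Qed.

Lemma ffun_of_freeK p : cancel (@ffun_of_free p) (@free_of_ffun p).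
Proof. by []. Qed.

Lemma free_of_ffunP p (a : k) (x y : {ffun 'I_p -> B}) :
  free_of_ffun (a *: x + y) =
  (a%:A : B^c) *: free_of_ffun x + free_of_ffun y.
Proof.
apply/ffunP => j; rewrite [LHS]ffunE [RHS]ffunE [X in X + _]ffunE.
by rewrite [X in _ = X + _]ffunE; congr (_ + _); exact/esym/(@mulr_algl k B^c).
Qed.

Lemma free_of_ffunZ p (a : k) (x : {ffun 'I_p -> B}) :
  free_of_ffun (a *: x) = (a%:A : B^c) *: free_of_ffun x.
Proof.
by rewrite -[a *: x]addr0 free_of_ffunP -[RHS]addr0; congr (_ + _).
Qed.

Lemma ffun_of_freeP p (a : k) (x y : free_mod B^c p) :
  ffun_of_free ((a%:A : B^c) *: x + y) = a *: ffun_of_free x + ffun_of_free y.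
Proof.
by apply: (can_inj (@free_of_ffunK p)); rewrite free_of_ffunP !ffun_of_freeK.
Qed.

Section Extend.
Variables (m n : nat) (P : lmodType B^c) (i : {linear P -> free_mod B^c n}).
Variables (g : 'I_m -> P) (q : {linear P -> free_mod B^c m}).
Hypotheses (i_inj : injective i) (qK : cancel q (lincomb g)).
Variable h : {linear P -> (B^c)^o}.

(* A k-linear functional on P restricting on P * DC to x * f |-> f (h x). *)
Definition dual_functional (x : P) : k^o :=
  \sum_j (q x j : B).2 (h (g j) : B).1.

(** The j-th coordinate of x f is (0, c_j f), with c_j the [C]-part of [q x j]; its value at h(g_j)
    is f(h(g_j) c_j), and these sum to f(h(x)). *)
Lemma dual_functional_ideal x f :
  dual_functional ((dual_ideal f : B^c) *: x) = f (h x : B).1.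
Proof.
rewrite -[x in RHS]qK lincombE linear_sum converse_sum1E linear_sum.
apply: eq_bigr => j _; rewrite linearZ ffunE linearZ converse_scale1E.
by rewrite [_ *: _]mul_dual_ideal; exact: dual_lmulE.
Qed.

Lemma dual_functionalP (a : k) x y :
  dual_functional ((a%:A : B^c) *: x + y) =
  a *: dual_functional x + dual_functional y.
Proof.
rewrite /dual_functional scaler_sumr -big_split; apply: eq_bigr => j _ /=.
have -> : q ((a%:A : B^c) *: x + y) j =
    (a *: ffun_of_free (q x) + ffun_of_free (q y)) j.
  by rewrite linearP -ffun_of_freeP.
by rewrite !ffunE /= add_lfunE scale_lfunE.
Qed.

Fact dual_functional_lincomb :
  linear (fun a : {ffun 'I_m -> B} =>
    dual_functional (lincomb g (free_of_ffun a))).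
Proof. by move=> a x y; rewrite free_of_ffunP linearP dual_functionalP. Qed.

Fact image_linear :
  linear (fun a : {ffun 'I_m -> B} =>
    ffun_of_free (i (lincomb g (free_of_ffun a)))).
Proof. by move=> a x y; rewrite free_of_ffunP !linearP ffun_of_freeP. Qed.

(** The functional and [i] are both pulled back along [lincomb g] to the k-space B^m; as [i] is
    injective, the first factors through the second and extends to B^n. *)
Lemma dual_functional_extend : exists2 t : {ffun 'I_n -> B} -> k^o,
  linear t & forall x, t (ffun_of_free (i x)) = dual_functional x.
Proof.
have [|t t_lin tE] := linear_factor image_linear dual_functional_lincomb.
  by move=> x y /(can_inj (@ffun_of_freeK n))/i_inj ->.
exists t => // x; rewrite -[x]qK -[q x]ffun_of_freeK; exact: tE.
Qed.

(** For fixed j, the map f |-> t(e_j f) is a functional on DC, hence evaluation at some c_j in [C].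
    Sending e_j to (c_j, 0) gives, on [C]-parts, f(h'(i x)) = t(i(x) f) = f(h(x)) for every f, and
    functionals separate [C]. *)
Lemma extend_mod_dual_ideal :
  exists h' : {linear free_mod B^c n -> (B^c)^o},
    forall x, (h' (i x) : B).1 = (h x : B).1.
Proof.
have [t t_lin tE] := dual_functional_extend.
have /choice[c cE] : forall j : 'I_n, exists c, forall f,
    t (ffun_of_free ((dual_ideal f : B^c) *: unit_vec B^c j)) = f c.
  move=> j; apply: dual_reflexive => a x y.
  by rewrite dual_idealP scalerDl -scalerA ffun_of_freeP t_lin.
exists (lincomb (fun j => ((c j, 0) : B) : (B^c)^o)) => x.
apply: dual_separates => f.
rewrite -dual_functional_ideal -tE linearZ /= converse_sum1E linear_sum.
rewrite [in RHS](free_sum (i x)) scaler_sumr.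
have t_sum (F : 'I_n -> free_mod B^c n) :
    t (ffun_of_free (\sum_j F j)) = \sum_j t (ffun_of_free (F j)).
  apply: (big_morph (fun y => t (ffun_of_free y))).
    by move=> y z; exact: (linearD (mklin t_lin)).
  exact: (linear0 (mklin t_lin)).
rewrite t_sum; apply: eq_bigr => j _.
by rewrite converse_scale1E scalerA mul_dual_ideal cE dual_lmulE.
Qed.
End Extend.

Lemma projective_submodule_split n (P : lmodType B^c)
    (i : {linear P -> free_mod B^c n}) :
  projective P -> finitely_generated P -> injective i ->
  exists r : {linear free_mod B^c n -> P}, cancel i r.
Proof.
move=> projP fgP i_inj; have [m [g [q qK]]] := projective_dual_basis projP fgP.
(* The coordinates of [q], extended along [i] modulo DC, assemble to [gam], a map from B^n to
   [P]. *)
pose qj j : P -> (B^c)^o := fun x => q x j.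
have qj_lin j : linear (qj j) by move=> a x y; rewrite /qj linearP !ffunE.
have /choice[h hE] j := extend_mod_dual_ideal i_inj qK (mklin (qj_lin j)).
have gam_lin : linear (fun y => \sum_j (h j y : B^c) *: g j).
  move=> a x y; rewrite scaler_sumr -big_split; apply: eq_bigr => j _ /=.
  by rewrite linearP scalerDl scalerA.
pose gam := mklin gam_lin.
have [u u_def] : exists u : {linear P -> P}, forall x, u x = x - gam (i x).
  by exists (idfun \- (gam \o i))%R.
(* The values of [u] lie in P * DC: the coefficients [nu j] have no [C]-part. *)
have uE x : exists2 nu : 'I_m -> B, (forall j, (nu j).1 = 0) &
    u x = \sum_j (nu j : B^c) *: g j.
  exists (fun j => qj j x - h j (i x)) => [j|].
    transitivity ((qj j x : B).1 - (h j (i x) : B).1); first by [].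
    by rewrite hE subrr.
  rewrite u_def /= -{1}(qK x) lincombE -sumrB; apply: eq_bigr => j _.
  by rewrite -scalerBl.
(* [u] sends each g_j into P * DC as well, and DC * DC = 0. *)
have uu x : u (u x) = 0.
  have [nu nu1 ->] := uE x; rewrite linear_sum big1 // => j _.
  rewrite linearZ /=.
  have [mu mu1 ->] := uE (g j); rewrite scaler_sumr big1 // => l _.
  rewrite scalerA (_ : _ * _ = 0) ?scale0r //.
  apply: (@dual_extP _ _ chi) => [|w]; first by rewrite /= mu1 mul0r.
  rewrite [LHS]dual_ext_mul2E nu1 mu1 mulr0 linear0 raddf0 mul0r addr0.
  by rewrite zero_lfunE.
(* The retraction is (1 + u) gam, since gam i = 1 - u and (1 + u)(1 - u) = 1. *)
exists (gam \+ (u \o gam))%R => x.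
have gi : gam (i x) = x - u x by rewrite u_def subKr.
rewrite [LHS]/(gam (i x) + u (gam (i x))) gi [u (_ - _)]linearB uu subr0.
exact: subrK.
Qed.
End Split.

(** A subspace contained in [W] of maximal dimension is all of [W], since a further vector of [W]
    would enlarge it. *)
Lemma subspace_vspace (k : fieldType) (V : vectType k) (W : V -> Prop) :
  W 0 -> (forall a x y, W x -> W y -> W (a *: x + y)) ->
  exists U : {vspace V}, forall x, x \in U <-> W x.
Proof.
move=> W0 WP; pose D d :=
  `[< exists2 U : {vspace V}, (forall x, x \in U -> W x) & \dim U = d >].
have exD : exists d, D d.
  exists 0%N; apply/asboolP; exists 0%VS; last exact: dimv0.
  by move=> x; rewrite memv0 => /eqP->.
have D_le d : D d -> (d <= \dim (@fullv k V))%N.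
  by move=> /asboolP[U _ <-]; apply: dimvS; exact: subvf.
case: (ex_maxnP exD D_le) => _ /asboolP[U UW <-] U_max.
exists U => x; split=> [/UW//|Wx].
have UxW y : y \in (U + <[x]>)%VS -> W y.
  move=> /memv_addP[u uU [_ /vlineP[a ->] ->]].
  by rewrite addrC; apply: WP => //; exact: UW.
have le_dim : (\dim (U + <[x]>) <= \dim U)%N.
  by apply: U_max; apply/asboolP; exists (U + <[x]>)%VS.
have /eqP-> : U == (U + <[x]>)%VS by rewrite eqEdim addvSl.
by apply: subvP (memv_line x); exact: addvSr.
Qed.

(** * Vanishing of the finitistic dimension for right B-modules *)

Section FindimDualExtension.
Variables (k : fieldType) (C : falgType k) (chi : {lrmorphism C -> k^o}).
Local Notation B := (dual_ext chi).

(** The kernel is a k-subspace of the finite dimensional space B^n, and a k-basis of it generates it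
    over [B^c]. *)
Lemma ker_finitely_generated n (M : lmodType B^c)
    (p : {linear free_mod B^c n -> M}) :
  finitely_generated (ker p).
Proof.
have [||U UE] := @subspace_vspace _ {ffun 'I_n -> B}
  (fun x => p (free_of_ffun x) = 0).
- exact: (linear0 p).
- by move=> a x y px py; rewrite free_of_ffunP linearP px py scaler0 addr0.
pose e := vbasis U.
apply: (@ker_fg _ _ _ p (\dim U) (fun i => free_of_ffun e`_i)) => [i|x px].
  by apply/UE/vbasis_mem/mem_nth; rewrite size_tuple.
exists (fun i => (coord e i (ffun_of_free x))%:A : B^c).
have xU : ffun_of_free x \in U by apply/UE.
have f_sum (F : 'I_(\dim U) -> {ffun 'I_n -> B}) :
    free_of_ffun (\sum_i F i) = \sum_i free_of_ffun (F i).
  exact: big_morph.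
rewrite -[LHS](ffun_of_freeK x) {1}(coord_vbasis xU) f_sum.
apply: eq_bigr => i _; exact: free_of_ffunZ.
Qed.

(** The syzygy of a free cover is finitely generated and, by induction, projective; its inclusion
    splits, so [M] is a direct summand of a free module. *)
Lemma pdle_dual_ext n (M : rmodType B) :
  finitely_generated M -> pdle n M -> projective M.
Proof.
elim: n M => // n IHn M fgM pdM.
have [m [g g_surj]] := fg_cover fgM.
have ks := ses_ker g_surj.
have pdK := pdle_syzygy ks (@free_projective _ _) pdM.
have fgK := ker_finitely_generated (lincomb g).
have projK := IHn _ fgK pdK.
have [r rK] := projective_submodule_split projK fgK (@val_inj _ _ _).
have [s sK] := ses_retract_section ks rK.
exact: projective_retract sK (@free_projective _ _).
Qed.

Lemma findim_dual_ext : (findim B < +oo)%E.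
Proof.
apply/findim_lt_pinfty; exists 0%N => M fgM [n pdM]; exact: pdle_dual_ext pdM.
Qed.
End FindimDualExtension.

(** * Restriction of scalars from A to T, where A = T e for an idempotent e *)

Section Restriction.
Variables (T A : pzRingType) (pi : {rmorphism T -> A}).
Implicit Types K M N P : lmodType A.

(** An alias of the carrier, keeping the action of [T] through [pi] apart from that of [A]. *)
Definition restrict (M : lmodType A) : Type := M.

Section RestrictModule.
Variable M : lmodType A.

HB.instance Definition _ := GRing.Zmodule.on (restrict M).

Definition restrict_scale (t : T) (x : restrict M) : restrict M :=
  pi t *: (x : M).

Fact restrict_scalerA a b x :
  restrict_scale a (restrict_scale b x) = restrict_scale (a * b) x.
Proof. by rewrite /restrict_scale scalerA rmorphM. Qed.

Fact restrict_scale1r : left_id 1 restrict_scale.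
Proof. by move=> x; rewrite /restrict_scale rmorph1 scale1r. Qed.

Fact restrict_scalerDr : right_distributive restrict_scale +%R.
Proof. by move=> a x y; rewrite /restrict_scale scalerDr. Qed.

Fact restrict_scalerDl x : {morph restrict_scale^~ x : a b / a + b}.
Proof. by move=> a b; rewrite /restrict_scale rmorphD scalerDl. Qed.

HB.instance Definition _ := GRing.Zmodule_isLmodule.Build T (restrict M)
  restrict_scalerA restrict_scale1r restrict_scalerDr restrict_scalerDl.

Lemma restrict_scaleE (t : T) (x : restrict M) : t *: x = pi t *: (x : M).
Proof. by []. Qed.
End RestrictModule.

Fact restrict_linear (M N : lmodType A) (f : {linear M -> N}) :
  linear (f : restrict M -> restrict N).
Proof. by move=> t x y; rewrite restrict_scaleE linearP. Qed.

Definition restrict_map M N (f : {linear M -> N}) := mklin (restrict_linear f).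

(* T e is A viewed as a T-module, for the idempotent e := sigma 1; [corner Y]
   below is e Y = Hom_T (A, Y). *)
Variable sigma : {additive A -> T}.
Hypotheses (sigmaK : cancel sigma pi)
  (mul_sigma : forall t a, t * sigma a = sigma (pi t * a)).

Lemma sigmaM a b : sigma a * sigma b = sigma (a * b).
Proof. by rewrite mul_sigma sigmaK. Qed.

Section Corner.
Variable Y : lmodType T.

Definition corner_pred : {pred Y} := fun y => sigma 1 *: y == y.

Fact corner_pred_zmod : zmod_closed corner_pred.
Proof.
split=> [|x y]; rewrite !unfold_in /= ?scaler0 //.
by move=> /eqP xE /eqP yE; rewrite scalerBr xE yE.
Qed.

HB.instance Definition _ := GRing.isZmodClosed.Build Y corner_pred
  corner_pred_zmod.

Definition corner := {y : Y | y \in corner_pred}.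

HB.instance Definition _ := SubChoice.on corner.
HB.instance Definition _ := [SubChoice_isSubZmodule of corner by <:].

Lemma corner_val (y : corner) : sigma 1 *: val y = val y.
Proof. exact: eqP (valP y). Qed.

Fact corner_scale_subproof a (y : Y) : sigma a *: y \in corner_pred.
Proof. by apply/eqP; rewrite scalerA sigmaM mul1r. Qed.

Definition corner_scale a (y : corner) : corner :=
  Sub (sigma a *: val y) (corner_scale_subproof a (val y)).

Fact corner_scalerA a b y :
  corner_scale a (corner_scale b y) = corner_scale (a * b) y.
Proof. by apply: val_inj; rewrite /= scalerA sigmaM. Qed.

Fact corner_scale1r : left_id 1 corner_scale.
Proof. by move=> y; apply: val_inj; exact: corner_val. Qed.

Fact corner_scalerDr : right_distributive corner_scale +%R.
Proof. by move=> a x y; apply: val_inj; exact: scalerDr. Qed.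

Fact corner_scalerDl y : {morph corner_scale^~ y : a b / a + b}.
Proof. by move=> a b; apply: val_inj; rewrite /= raddfD scalerDl. Qed.

HB.instance Definition _ := GRing.Zmodule_isLmodule.Build A corner
  corner_scalerA corner_scale1r corner_scalerDr corner_scalerDl.

Lemma cornerP (y : Y) : sigma 1 *: y = y <-> exists z : corner, val z = y.
Proof.
split=> [yE|[z <-]]; last exact: corner_val.
have cy : y \in corner_pred by [apply/eqP].
by exists (Sub y cy).
Qed.
End Corner.

(** Restriction is left adjoint to Y |-> e Y: a [T]-map out of [restrict P] lands in the corner
    because e = [sigma 1] acts as 1 on [restrict P]. Corners preserve surjections, so the lift can
    be made over [A]. *)
Lemma projective_restrict P : projective P -> projective (restrict P).
Proof.
move=> projP Y Z p f p_surj.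
have /choice[f' f'E] (x : P) : exists z : corner Z, val z = f x.
  apply/cornerP; rewrite -linearZ; congr (f _).
  by rewrite restrict_scaleE sigmaK scale1r.
have f'_lin : linear f'.
  move=> a x y; apply: val_inj; rewrite [RHS]raddfD /= !f'E -linearZ -linearD.
  by congr (f _); rewrite restrict_scaleE sigmaK.
have /choice[p' p'E] (y : corner Y) : exists z : corner Z, val z = p (val y).
  by apply/cornerP; rewrite -linearZ corner_val.
have p'_lin : linear p'.
  move=> a x y; apply: val_inj; rewrite [RHS]raddfD /= !p'E -linearZ -linearD.
  by [].
have p'_surj z : exists y, mklin p'_lin y = z.
  have [y py] := p_surj (val z).
  (* A preimage multiplied by e lies in the corner and still maps to [z]. *)
  have [y' y'E] : exists y' : corner Y, val y' = sigma 1 *: y.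
    by apply/cornerP; rewrite scalerA sigmaM mul1r.
  exists y'; apply: val_inj; rewrite /= p'E y'E linearZ /= py.
  exact: corner_val.
have [h hE] := projP _ _ (mklin p'_lin) (mklin f'_lin) p'_surj.
have h'_lin : linear (fun x : restrict P => val (h x)).
  move=> t x y; rewrite restrict_scaleE linearP.
  transitivity (sigma (pi t) *: val (h x) + val (h y)); first by [].
  (* Here sigma(pi t) = t e, and e fixes the corner. *)
  by rewrite -[pi t]mulr1 -mul_sigma -scalerA corner_val.
exists (mklin h'_lin) => x /=; rewrite -p'E -f'E.
by congr val; exact: hE.
Qed.

(** As [pi] is surjective, [T]-linear maps between restricted modules are [A]-linear. *)
Lemma restrict_projective P : projective (restrict P) -> projective P.
Proof.
move=> projP Y Z p f p_surj.
have [h hE] := projP _ _ (restrict_map p) (restrict_map f) p_surj.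
have h_lin : linear (h : P -> Y).
  move=> a x y; rewrite -[a]sigmaK -restrict_scaleE; exact: linearP.
by exists (mklin h_lin).
Qed.

Lemma ses_restrict K P M (j : {linear K -> P}) (p : {linear P -> M}) :
  ses j p -> ses (restrict_map j) (restrict_map p).
Proof. by []. Qed.

Lemma pdle_restrict n M : pdle n M -> pdle n (restrict M).
Proof.
elim: n M => [|n IHn] M; first exact: projective_restrict.
move=> [K [P [j [p [projP jp pdK]]]]].
exists (restrict K), (restrict P), (restrict_map j), (restrict_map p).
by split; [exact: projective_restrict | exact: ses_restrict | exact: IHn].
Qed.

(** Unless [M] is projective, the bound [m] provides a syzygy sequence over [A] whose projective
    term stays projective over [T]; Schanuel's lemma over [T] then lowers [n] for the kernel. *)
Lemma pdle_restrict_inv m n M :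
  pdle m M -> pdle n (restrict M) -> pdle n M.
Proof.
elim: n m M => [|n IHn] [|m] M; try by move=> _; exact: restrict_projective.
  by move=> projM _; exact: pdle_le (leq0n _) projM.
move=> [K [P [j [p [projP jp pdK]]]]] pdM.
exists K, P, j, p; split=> //; apply: IHn pdK _.
exact: pdle_syzygy (ses_restrict jp) (projective_restrict projP) pdM.
Qed.

Lemma fg_restrict M : finitely_generated M -> finitely_generated (restrict M).
Proof.
move=> [n [g Mg]]; exists n, g => x; have [a ->] := Mg x.
exists (sigma \o a); apply: eq_bigr => i _.
by rewrite restrict_scaleE /= sigmaK.
Qed.

End Restriction.

(** * Transfer of the bound from the opposite of B to L *)

Section OppositeBound.
Variables (k : fieldType) (L : falgType k).

Local Notation C := (L^c * k^o)%type.
Definition char_snd : {lrmorphism C -> k^o} := snd.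
Local Notation B := (dual_ext char_snd).

(** Right [B^c]-modules are modules over [(B^c)^c], which multiplies as [B]; right [L]-modules are
    modules over [L^c], the first factor of [C]. *)
Definition corner_proj (b : (B^c)^c) : L^c := (b : B).1.1.

Fact corner_proj_additive : zmod_morphism corner_proj.
Proof. by []. Qed.

Fact corner_proj_multiplicative : monoid_morphism corner_proj.
Proof. by []. Qed.

HB.instance Definition _ := GRing.isZmodMorphism.Build _ _ corner_proj
  corner_proj_additive.
HB.instance Definition _ := GRing.isMonoidMorphism.Build _ _ corner_proj
  corner_proj_multiplicative.

(** Identifies [L^c] with the left ideal B e, where e = ((1, 0), 0). *)
Definition corner_incl (a : L^c) : (B^c)^c := ((a, 0), 0) : B.

Fact corner_incl_additive : zmod_morphism corner_incl.
Proof.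
move=> x y; apply: (@dual_extP _ _ char_snd) => [|w]; last by rewrite /= subrr.
by congr (_, _); rewrite /= subrr.
Qed.

HB.instance Definition _ := GRing.isZmodMorphism.Build _ _ corner_incl
  corner_incl_additive.

Lemma corner_inclK : cancel corner_incl corner_proj.
Proof. by []. Qed.

(** The DC-part of [b] gets multiplied by [char_snd (a, 0)], which is 0, so the product stays in the
    image of [L^c]. *)
Lemma mul_corner_incl (b : (B^c)^c) a :
  b * corner_incl a = corner_incl (corner_proj b * a).
Proof.
apply: (@dual_extP _ _ char_snd) => [|w]; first by congr (_, _); exact: mulr0.
by rewrite [LHS]dual_ext_mul2E /= !zero_lfunE mul0r addr0.
Qed.

Lemma findim_opposite_dual_ext :
  (findim (B^c)%type < +oo)%E -> (findim L < +oo)%E.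
Proof.
move=> /findim_lt_pinfty[N leN]; apply/findim_lt_pinfty.
exists N => M fgM [n Mn].
apply: (pdle_restrict_inv corner_inclK mul_corner_incl Mn); apply: leN.
  exact: (fg_restrict corner_inclK).
by exists n; exact: (pdle_restrict corner_inclK mul_corner_incl).
Qed.

End OppositeBound.

Theorem theorem1 :
  (forall (k : fieldType) (L : falgType k), (findim L < +oo)%E)
  <->
  (forall (k : fieldType) (L : falgType k),
     (findim L < +oo)%E -> (findim (L^c)%type < +oo)%E).
Proof.
split=> [fin k L _|sym k L]; first exact: fin.
(* Statement (ii) is applied to [B], whose finitistic dimension is finite; the resulting bound for
   its opposite bounds that of [L]. *)
exact/findim_opposite_dual_ext/sym/findim_dual_ext.
Qed.
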